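(* Let $x,y,u,v,p_+,p_-,q_+,q_-$ be indeterminates, and for $n\ge0$ define $M_n(x,y,u,v,p_+,p_-,q_+,q_-)$ by the following two expressions, which are asserted to be equal: $$M_n(x,y,u,v,p_+,p_-,q_+,q_-)=\sum_{\sigma\in\mathcal I_{2n}}x^{\mathrm{ecpar}(\sigma)}y^{\mathrm{ocpar}(\sigma)}u^{\mathrm{ecpnar}(\sigma)}v^{\mathrm{ocpnar}(\sigma)}\,p_+^{\mathrm{ocr}(\sigma)}p_-^{\mathrm{ecr}(\sigma)}q_+^{\mathrm{one}(\sigma)}q_-^{\mathrm{ene}(\sigma)}$$ $$\qquad=\sum_{\sigma\in\mathcal I_{2n}}x^{\mathrm{ocvr}(\sigma)}y^{\mathrm{ecvr}(\sigma)}u^{\mathrm{ocvnr}(\sigma)}v^{\mathrm{ecvnr}(\sigma)}\,p_+^{\mathrm{ecr}(\sigma)}p_-^{\mathrm{ocr}(\sigma)}q_+^{\mathrm{ene}(\sigma)}q_-^{\mathrm{one}(\sigma)},$$ where the sums run over the set $\mathcal I_{2n}$ of fixed-point-free involutions of $[2n]$ (the two expressions being related by the bijection $\sigma\mapsto R\circ\sigma\circ R$ with $R(i)=2n+1-i$). Then the ordinary generating function of these polynomials has the S-type continued fraction $$\sum_{n=0}^\infty M_n(x,y,u,v,p_+,p_-,q_+,q_-)\,t^n=\cfrac{1}{1-\cfrac{\alpha_1t}{1-\cfrac{\alpha_2t}{1-\cfrac{\alpha_3t}{1-\cdots}}}}$$ with coefficients, for $k\ge1$, $$\alpha_{2k-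1}=p_-^{2k-2}x+q_-[2k-2]_{p_-,q_-}u,\qquad\alpha_{2k}=p_+^{2k-1}y+q_+[2k-1]_{p_+,q_+}v.$$
   Context: $[n]_{p,q}=\sum_{j=0}^{n-1}p^jq^{n-1-j}$ (so $[0]_{p,q}=0$), and $[2n]=\{1,\dots,2n\}$. Continued fractions are identities of formal power series in $t$. For a permutation $\sigma$ of $[2n]$, an index $i$ is a record if $\sigma(j)<\sigma(i)$ for all $j<i$, and an antirecord if $\sigma(j)>\sigma(i)$ for all $j>i$. It is a cycle peak if $\sigma^{-1}(i)<i>\sigma(i)$ and a cycle valley if $\sigma^{-1}(i)>i<\sigma(i)$; for a fixed-point-free involution, the cycle peaks (resp. cycle valleys) are the largest (resp. smallest) elements of the 2-cycles. $\mathrm{ecpar}(\sigma)$, $\mathrm{ocpar}(\sigma)$, $\mathrm{ecpnar}(\sigma)$, $\mathrm{ocpnar}(\sigma)$ are the numbers of cycle peaks $i$ that are, respectively: even and an antirecord; odd and an antirecord; even and not an antirecord; odd and not an antirecord. $\mathrm{ecvr}(\sigma)$, $\mathrm{ocvr}(\sigma)$, $\mathrm{ecvnr}(\sigma)$, $\mathrm{ocvnr}(\sigma)$ are the numbers of cycle valleys $i$ that are, respectively: even and a record; odd and a record; even and not a record; odd and not a record. For a fixed-point-free involution $\sigma$, a quadruplet $i<j<k<l$ is a crossing if $\sigma(i)=k$ and $\sigma(j)=l$, and a nesting if $\sigma(i)=l$ and $\sigma(j)=k$. A crossing or nesting $i<j<k<l$ is called even (resp. odd) if the element in second position, $j$,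 is even (resp. odd). $\mathrm{ecr}(\sigma)$, $\mathrm{ocr}(\sigma)$, $\mathrm{ene}(\sigma)$, $\mathrm{one}(\sigma)$ are the numbers of even crossings, odd crossings, even nestings and odd nestings of $\sigma$, respectively.
   Formalization: In the first sum (over cycle peaks) the parity of a crossing or nesting i<j<k<l is read on the third element k instead of the second element j; with j the two sums already differ at n=2 (xy p_- + xv q_- against xy p_+ + xv q_+). *)

(* Defs.v *)
From HB Require Import structures.
From mathcomp Require Import all_boot all_order all_fingroup all_algebra.
From mathcomp Require Import mpoly.

Set Implicit Arguments.
Unset Strict Implicit.
Unset Printing Implicit Defensive.

Import GRing.Theory.

(** * Permutations of {1, ..., N}

   The element i of {1, ..., N} is the ordinal of value i - 1 in 'I_N; hence
   parities are those of i.+1. *)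

Section Statistics.
Variable N : nat.
Implicit Types (s : {perm 'I_N}) (i j k l : 'I_N).

Definition elt_odd i : bool := odd i.+1.
Definition elt_even i : bool := ~~ odd i.+1.

Definition is_record s i : bool := [forall j : 'I_N, (j < i) ==> (s j < s i)].
Definition is_antirecord s i : bool :=
  [forall j : 'I_N, (i < j) ==> (s i < s j)].

Definition is_cpeak s i : bool := ((s^-1)%g i < i) && (s i < i).
Definition is_cvalley s i : bool := (i < (s^-1)%g i) && (i < s i).

Definition ecpar s : nat :=
  #|[set i | [&& is_cpeak s i, elt_even i & is_antirecord s i]]|.
Definition ocpar s : nat :=
  #|[set i | [&& is_cpeak s i, elt_odd i & is_antirecord s i]]|.
Definition ecpnar s : nat :=
  #|[set i | [&& is_cpeak s i, elt_even i & ~~ is_antirecord s i]]|.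
Definition ocpnar s : nat :=
  #|[set i | [&& is_cpeak s i, elt_odd i & ~~ is_antirecord s i]]|.

Definition ecvr s : nat :=
  #|[set i | [&& is_cvalley s i, elt_even i & is_record s i]]|.
Definition ocvr s : nat :=
  #|[set i | [&& is_cvalley s i, elt_odd i & is_record s i]]|.
Definition ecvnr s : nat :=
  #|[set i | [&& is_cvalley s i, elt_even i & ~~ is_record s i]]|.
Definition ocvnr s : nat :=
  #|[set i | [&& is_cvalley s i, elt_odd i & ~~ is_record s i]]|.

Definition is_fpf_involution s : bool :=
  [forall i, (s (s i) == i) && (s i != i)].

Definition is_crossing s i j k l : bool :=
  [&& i < j, j < k, k < l, s i == k & s j == l].
Definition is_nesting s i j k l : bool :=
  [&& i < j, j < k, k < l, s i == l & s j == k].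

Definition count_quadruplets (P : 'I_N -> 'I_N -> 'I_N -> 'I_N -> bool) : nat :=
  #|[set q : 'I_N * 'I_N * 'I_N * 'I_N | P q.1.1.1 q.1.1.2 q.1.2 q.2]|.

Definition ecr s : nat :=
  count_quadruplets (fun i j k l => is_crossing s i j k l && elt_even j).
Definition ocr s : nat :=
  count_quadruplets (fun i j k l => is_crossing s i j k l && elt_odd j).
Definition ene s : nat :=
  count_quadruplets (fun i j k l => is_nesting s i j k l && elt_even j).
Definition one s : nat :=
  count_quadruplets (fun i j k l => is_nesting s i j k l && elt_odd j).

(** The same numbers, with the parity read on the element in third position,
   i.e. on the smaller of the two cycle peaks of the quadruplet. Reversal
   i |-> N + 1 - i exchanges the second and third positions, so it carries
   these to the statistics above. *)
Definition ecr3 s : nat :=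
  count_quadruplets (fun i j k l => is_crossing s i j k l && elt_even k).
Definition ocr3 s : nat :=
  count_quadruplets (fun i j k l => is_crossing s i j k l && elt_odd k).
Definition ene3 s : nat :=
  count_quadruplets (fun i j k l => is_nesting s i j k l && elt_even k).
Definition one3 s : nat :=
  count_quadruplets (fun i j k l => is_nesting s i j k l && elt_odd k).

Definition rev_perm : {perm 'I_N} := perm (@rev_ord_inj N).

(** sigma |-> R o sigma o R *)
Definition rev_conj s : {perm 'I_N} := (rev_perm * s * rev_perm)%g.

End Statistics.

Definition fpf_involutions (n : nat) : {set {perm 'I_(2 * n)}} :=
  [set s | is_fpf_involution s].

Local Open Scope ring_scope.

(** * The polynomials *)

Definition pol := {mpoly int[8]}.

Definition x_ : pol := 'X_(inord 0).
Definition y_ : pol := 'X_(inord 1).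
Definition u_ : pol := 'X_(inord 2).
Definition v_ : pol := 'X_(inord 3).
Definition p_plus : pol := 'X_(inord 4).
Definition p_minus : pol := 'X_(inord 5).
Definition q_plus : pol := 'X_(inord 6).
Definition q_minus : pol := 'X_(inord 7).

(** The parity of a crossing or nesting is read on its third element here, and
   on its second element in [weight_valley]. With the second element in both,
   the two sums already differ for n = 2: they would be
     x^2 + x y p_minus + x v q_minus  and  x^2 + x y p_plus + x v q_plus,
   and only the latter is the coefficient of t^2 in the continued fraction. *)
Definition weight_peak (N : nat) (s : {perm 'I_N}) : pol :=
  x_ ^+ ecpar s * y_ ^+ ocpar s * u_ ^+ ecpnar s * v_ ^+ ocpnar s
  * p_plus ^+ ocr3 s * p_minus ^+ ecr3 s
  * q_plus ^+ one3 s * q_minus ^+ ene3 s.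

Definition weight_valley (N : nat) (s : {perm 'I_N}) : pol :=
  x_ ^+ ocvr s * y_ ^+ ecvr s * u_ ^+ ocvnr s * v_ ^+ ecvnr s
  * p_plus ^+ ecr s * p_minus ^+ ocr s
  * q_plus ^+ ene s * q_minus ^+ one s.

Definition M_peak (n : nat) : pol :=
  \sum_(s in fpf_involutions n) weight_peak s.
Definition M_valley (n : nat) : pol :=
  \sum_(s in fpf_involutions n) weight_valley s.

Definition pq_int (R : nzRingType) (p q : R) (n : nat) : R :=
  \sum_(j < n) p ^+ j * q ^+ (n - 1 - j).

(** * Formal power series and S-type continued fractions

   A formal power series is its sequence of coefficients. *)

Section PowerSeries.
Variable R : comNzRingType.

Definition fps := nat -> R.
Implicit Types (f g : fps) (a : R).

Definition fps_one : fps := fun n => (n == 0%N)%:R.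
Definition fps_sub f g : fps := fun n => f n - g n.
Definition fps_mul f g : fps := fun n => \sum_(i < n.+1) f i * g (n - i)%N.
Definition fps_exp f k : fps := iter k (fps_mul f) fps_one.

(** a * t * f(t) *)
Definition fps_scale_shift a f : fps := fun n => if n is m.+1 then a * f m else 0.

(** 1 / (1 - g(t)) for g(0) = 0, as the geometric series: g ^ k has no term of
   degree less than k, so the coefficient of t^n only involves k <= n. *)
Definition fps_inv1B g : fps := fun n => \sum_(k < n.+1) fps_exp g k n.

Lemma fps_exp_small g k n : g 0%N = 0 -> (n < k)%N -> fps_exp g k n = 0.
Proof.
move=> g0; elim: k n => [//|k IHk] n lt_nk.
rewrite /fps_exp iterS -/(fps_exp g k) /fps_mul big1 // => -[[|i] /= lt_in] _.
  by rewrite g0 mul0r.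
rewrite IHk ?mulr0 //.
by case: n lt_nk lt_in => // n lt_nk _; rewrite subSS (leq_ltn_trans (leq_subr _ _)).
Qed.

Lemma fps_mul_inv1B g :
  g 0%N = 0 -> fps_mul (fps_sub fps_one g) (fps_inv1B g) =1 fps_one.
Proof.
move=> g0 n; pose F k m := fps_exp g k m.
have invE m : (m <= n)%N -> fps_inv1B g m = \sum_(k < n.+1) F k m.
  move=> le_mn; rewrite /fps_inv1B (big_ord_widen n.+1 (fun k => F k m)) //.
  rewrite big_mkcond; apply: eq_bigr => k _.
  by case: ltnP => // lt_mk; rewrite /F fps_exp_small.
rewrite /fps_mul; under eq_bigr do rewrite invE ?leq_subr // mulr_sumr.
rewrite exchange_big /=.
have step k : \sum_(i < n.+1) fps_sub fps_one g i * F k (n - i)%N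
              = F k n - F k.+1 n.
  under eq_bigr do rewrite /fps_sub mulrBl.
  rewrite big_split /= sumrN; congr (_ - _).
  rewrite big_ord_recl /= subn0 mul1r big1 ?addr0 // => i _.
  by rewrite /fps_one /= mul0r.
under eq_bigr do rewrite step.
rewrite -(big_mkord xpredT (fun k => F k n - F k.+1 n)).
rewrite (eq_bigr (fun k => - (F k.+1 n - F k n))); last by move=> k _; rewrite opprB.
by rewrite sumrN telescope_sumr // opprB {2}/F fps_exp_small // subr0.
Qed.

(** The finite continued fraction
     1 / (1 - alpha_k t / (1 - alpha_(k+1) t / ( ... / (1 - alpha_(k+d-1) t)))) *)
Fixpoint Sfrac_trunc (alpha : nat -> R) (k d : nat) : fps :=
  if d is d'.+1
  then fps_inv1B (fps_scale_shift (alpha k) (Sfrac_trunc alpha k.+1 d'))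
  else fps_one.

(** Convergence of formal power series: every coefficient is eventually
   constant. *)
Definition fps_cvg (F : nat -> fps) f : Prop :=
  forall m, exists d0, forall d, (d0 <= d)%N -> F d m = f m.

(** f is the infinite continued fraction
     1 / (1 - alpha_1 t / (1 - alpha_2 t / (1 - ... ))) *)
Definition is_Sfrac (alpha : nat -> R) f : Prop :=
  fps_cvg (Sfrac_trunc alpha 1) f.

End PowerSeries.

(* Main.v *)
Require Import Defs.
From HB Require Import structures.
From mathcomp Require Import all_boot all_order all_fingroup all_algebra.
From mathcomp Require Import mpoly zify.

Set Implicit Arguments.
Unset Strict Implicit.
Unset Printing Implicit Defensive.

Import GRing.Theory.
Local Open Scope ring_scope.

(** Conjugation by the reversal of [1, 2n] exchanges peaks with valleys,
   records with antirecords, the second element of a quadruplet with the third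
   and, the size being even, odd elements with even ones; this identifies the
   two sums ([weight_rev]).

   For the continued fraction, call an arc of the involution s a pair i < s i,
   and the height at a position j the number of arcs i < j <= s i. Every
   crossing or nesting is charged to its second element j, which is a valley,
   and its first element ranges over the arcs i < j < s i: such an arc crosses
   the arc of j when s i < s j and nests over it when s j < s i. Moreover j is a
   record exactly when no arc nests over it. The weight of s is therefore a
   product over the valleys j of a factor that depends on the parity of j, the
   number k of arcs nesting over j and the number c of arcs crossing it
   ([weight_valleyE]), with k + c the height h at j. Since h and j - 1 have the
   same parity, the factors for k = 0, ..., h add up to alpha_(h+1)
   ([sum_factors]).

   These choices of k are independent of each other. Reading the positions from
   right to left, a peak becomes an unmatched element, and a valley chooses its
   partner among the elements unmatched so far; choosing the partner that has k
   unmatched elements on its right is the same as choosing k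
   ([sum_extensions]). Hence the sum over all involutions is the sum over Dyck
   paths of length 2n in which a rise from height h to h + 1 weighs alpha_(h+1)
   ([path_sum_valley]).

   That weighted Dyck paths are counted by the S-fraction is Flajolet's theorem
   ([path_sum_is_Sfrac]). If T_h is the tail 1 / (1 - alpha_(h+1) t / ...), then
   T_h = 1 + alpha_(h+1) t T_(h+1) T_h, so the products V_h = T_(h-1) ... T_0
   satisfy V_(h+1) = V_h + alpha_(h+1) t V_(h+2). This is the recursion on the
   last step satisfied by the paths from 0 to h, once the factor
   alpha_1 ... alpha_h of the h rises that are never undone is removed. *)

(** * Weighted Dyck paths and S-fractions *)

Section Fractions.
Variable R : comNzRingType.
Implicit Types (f g : fps R) (a : R) (alpha : nat -> R).

(** Truncating the series to polynomials gives access to the ring laws of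
   polynomials. *)
Lemma fps_mul_coef f g N n : (n < N)%N ->
  fps_mul f g n = ((\poly_(i < N) f i) * (\poly_(i < N) g i))`_n.
Proof.
move=> lt_nN; rewrite coefM; apply: eq_bigr => i _; rewrite !coef_poly.
by rewrite (leq_ltn_trans _ lt_nN) ?(leq_ltn_trans (leq_subr _ _) lt_nN) // -ltnS.
Qed.

Lemma fps_mulA f g (h : fps R) : fps_mul f (fps_mul g h) =1 fps_mul (fps_mul f g) h.
Proof.
move=> n; pose P (e : fps R) := \poly_(i < n.+1) e i.
have coefPM e e' i : (i <= n)%N -> (P (fps_mul e e'))`_i = (P e * P e')`_i.
  by move=> le_in; rewrite coef_poly ltnS le_in (@fps_mul_coef _ _ n.+1).
rewrite !(@fps_mul_coef _ _ n.+1) // -/(P _) -/(P _) -/(P _) -/(P _).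
transitivity (P f * (P g * P h))`_n.
  by rewrite !coefM; apply: eq_bigr => i _; rewrite coefPM ?leq_subr.
rewrite mulrA !coefM; apply: eq_bigr => i _.
by rewrite [in RHS]coefPM // -ltnS.
Qed.

Lemma fps_inv1B0 g : fps_inv1B g 0%N = 1.
Proof. by rewrite /fps_inv1B big_ord1. Qed.

(** The coefficient form of F = 1 + a t f F. *)
Lemma fps_inv1B_rec a f n (F := fps_inv1B (fps_scale_shift a f)) :
  F n.+1 = a * fps_mul f F n.
Proof.
have := @fps_mul_inv1B _ (fps_scale_shift a f) erefl n.+1.
rewrite /fps_mul big_ord_recl /= subn0 /fps_sub /fps_one /= subr0 mul1r -/F.
move/eqP; rewrite addr_eq0 => /eqP ->; rewrite -sumrN mulr_sumr.
by apply: eq_bigr => i _; rewrite sub0r mulNr opprK mulrA.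
Qed.

(** The weighted number of nonnegative lattice paths of [m] steps from height 0
   to height [h], a rise to height k weighing [alpha k] and a fall weighing 1,
   by recursion on the last step. *)
Fixpoint path_sum alpha (m h : nat) : R :=
  if m is m'.+1 then
    path_sum alpha m' h.+1 + (if h is h'.+1 then alpha h * path_sum alpha m' h' else 0)
  else (h == 0%N)%:R.

Lemma path_sum_small alpha m h : (m < h)%N -> path_sum alpha m h = 0.
Proof.
elim: m h => [|m IHm] [|h] //= lt_mh.
by rewrite !IHm ?mulr0 ?addr0 //; lia.
Qed.

(** The product of the tails T_(h-1) ... T_0 of the fraction cut after its first
   [d] coefficients: level h' has [d - h'] coefficients left. *)
Fixpoint Sfrac_prod alpha (d h : nat) : fps R :=
  if h is h'.+1
  then fps_mul (Sfrac_trunc alpha h (d - h')) (Sfrac_prod alpha d h')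
  else fps_one R.

(** This is T_h = 1 + alpha_(h+1) t T_(h+1) T_h multiplied by T_(h-1) ... T_0. *)
Lemma Sfrac_prod_rec alpha d h n : (h < d)%N ->
  Sfrac_prod alpha d h.+1 n.+1
  = Sfrac_prod alpha d h n.+1 + alpha h.+1 * Sfrac_prod alpha d h.+2 n.
Proof.
move=> lt_hd; rewrite [LHS]/= {1}/fps_mul big_ord_recl /= subn0.
rewrite -(subnSK lt_hd) /=.
rewrite fps_inv1B0 mul1r; congr (_ + _).
rewrite fps_mulA /fps_mul mulr_sumr; apply: eq_bigr => i _.
by rewrite fps_inv1B_rec mulrA.
Qed.

Lemma Sfrac_prod0 alpha d h : Sfrac_prod alpha d h 0%N = 1.
Proof.
elim: h => //= h IHh; rewrite /fps_mul big_ord1 IHh mulr1.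
by case: (d - h)%N => //= e; rewrite fps_inv1B0.
Qed.

(** A path of n falls from 0 to h has n + h rises. Splitting it at its last
   visits to the heights 0, ..., h - 1 leaves h rises that are never undone,
   of total weight alpha_1 ... alpha_h, and h + 1 excursions, one for each tail.
   Cutting the fraction after [d] coefficients only affects paths that go above
   height [d], and these have more than [d] rises. *)
Lemma path_sum_Sfrac_prod alpha d n h : (n + h <= d)%N ->
  path_sum alpha (n.*2 + h) h
  = \prod_(k < h) alpha k.+1 * Sfrac_prod alpha d h.+1 n.
Proof.
move: {2}(n.*2 + h)%N (erefl (n.*2 + h)%N) => m.
elim: m n h => [|m IHm] n h def_m le_d; rewrite def_m.
  have [-> ->] : n = 0%N /\ h = 0%N by lia.
  by rewrite big_ord0 Sfrac_prod0 mulr1.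
(* The term of the last step being a rise, in terms of V_h. *)
have rise : (if h is h'.+1 then alpha h * path_sum alpha m h' else 0)
            = \prod_(k < h) alpha k.+1 * Sfrac_prod alpha d h n.
  case: h def_m le_d => [|h] def_m le_d.
    by case: n def_m {le_d} => //= n _; rewrite mulr0.
  have {}def_m : (n.*2 + h)%N = m by lia.
  rewrite -{1}def_m IHm //; last by lia.
  by rewrite big_ord_recr /= mulrCA mulrA.
rewrite [LHS]/= rise; case: n def_m le_d {rise} => [|n] def_m le_d.
  by rewrite path_sum_small ?add0r ?Sfrac_prod0 //; lia.
have {}def_m : (n.*2 + h.+1)%N = m by lia.
rewrite -def_m IHm //; last by lia.
rewrite Sfrac_prod_rec; last by lia.
by rewrite big_ord_recr /= mulrDr addrC -!mulrA.
Qed.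

Lemma path_sum_is_Sfrac alpha : is_Sfrac alpha (fun n => path_sum alpha n.*2 0).
Proof.
move=> m; exists m => d le_md.
have := @path_sum_Sfrac_prod alpha d m 0; rewrite !addn0 => -> //.
rewrite big_ord0 mul1r /= subn0 /fps_mul big_ord_recr /= subnn mulr1.
by rewrite big1 ?add0r // => i _; rewrite /fps_one subn_eq0 leqNgt ltn_ord mulr0.
Qed.

Lemma is_Sfrac_eq alpha f g : f =1 g -> is_Sfrac alpha f -> is_Sfrac alpha g.
Proof.
by move=> fg cvg m; have [d0 d0P] := cvg m; exists d0 => d /d0P ->; apply: fg.
Qed.

End Fractions.

(** * Fixed-point-free involutions and reversal *)

Lemma card_set_inj (T : finType) (f : T -> T) (P Q : pred T) :
  injective f -> (forall x, P x = Q (f x)) -> #|[set x | P x]| = #|[set x | Q x]|.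
Proof.
move=> f_inj PQ; rewrite -!sum1dep_card [RHS](reindex_inj f_inj).
exact: eq_bigl.
Qed.

Section FixedPointFree.
Variable N : nat.
Implicit Types (s : {perm 'I_N}) (i j : 'I_N).

Lemma fpf_involutionP s :
  reflect (involutive s /\ forall i, s i != i) (is_fpf_involution s).
Proof.
apply: (iffP forallP) => [sP | [sK s_fpf] i]; last by rewrite sK eqxx s_fpf.
by split=> i; have /andP[/eqP] := sP i.
Qed.

Lemma invol_eq s i j : involutive s -> (s i == j) = (s j == i).
Proof. by move=> sK; rewrite eq_sym (can2_eq sK sK). Qed.

End FixedPointFree.

Section Reversal.
Variable N : nat.
Implicit Types s : {perm 'I_N}.

Lemma rev_conjE s i : rev_conj s i = rev_ord (s (rev_ord i)).
Proof. by rewrite /rev_conj !permM !permE. Qed.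

Lemma rev_conjK : involutive (@rev_conj N).
Proof. by move=> s; apply/permP=> i; rewrite !rev_conjE !rev_ordK. Qed.

Lemma rev_conjV s : (rev_conj s)^-1%g = rev_conj s^-1%g.
Proof.
apply/eqP; rewrite eq_invg_mul; apply/eqP/permP => i.
by rewrite permM !rev_conjE rev_ordK permK rev_ordK perm1.
Qed.

Lemma rev_conj_fpf s : is_fpf_involution (rev_conj s) = is_fpf_involution s.
Proof.
suff imp (r : {perm 'I_N}) : is_fpf_involution r -> is_fpf_involution (rev_conj r).
  by apply/idP/idP => /imp; rewrite ?rev_conjK.
case/fpf_involutionP=> rK r_fpf; apply/fpf_involutionP; split=> i.
  by rewrite !rev_conjE rev_ordK rK rev_ordK.
by rewrite rev_conjE -(inj_eq rev_ord_inj) rev_ordK.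
Qed.

Lemma ltn_rev (i j : 'I_N) : (rev_ord i < rev_ord j)%N = (j < i)%N.
Proof. by rewrite /=; have [lt_iN lt_jN] : (i < N)%N /\ (j < N)%N by []; lia. Qed.

Lemma is_record_rev s i : is_record (rev_conj s) (rev_ord i) = is_antirecord s i.
Proof.
apply/forallP/forallP => rec_i j; last rewrite -[j]rev_ordK.
  by have := rec_i (rev_ord j); rewrite !rev_conjE !rev_ordK !ltn_rev.
by rewrite ltn_rev !rev_conjE ltn_rev !rev_ordK; apply: rec_i.
Qed.

Lemma is_cvalley_rev s i : is_cvalley (rev_conj s) (rev_ord i) = is_cpeak s i.
Proof. by rewrite /is_cvalley rev_conjV !rev_conjE !rev_ordK !ltn_rev. Qed.

Lemma is_crossing_rev s i j k l : involutive s ->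
  is_crossing (rev_conj s) (rev_ord l) (rev_ord k) (rev_ord j) (rev_ord i)
  = is_crossing s i j k l.
Proof.
move=> sK; rewrite /is_crossing !rev_conjE !rev_ordK !ltn_rev.
rewrite !(inj_eq rev_ord_inj) [s l == j]invol_eq // [s k == i]invol_eq //.
by case: (i < j)%N; case: (j < k)%N; case: (k < l)%N; rewrite //= andbC.
Qed.

Lemma is_nesting_rev s i j k l : involutive s ->
  is_nesting (rev_conj s) (rev_ord l) (rev_ord k) (rev_ord j) (rev_ord i)
  = is_nesting s i j k l.
Proof.
move=> sK; rewrite /is_nesting !rev_conjE !rev_ordK !ltn_rev.
rewrite !(inj_eq rev_ord_inj) [s l == i]invol_eq // [s k == j]invol_eq //.
by case: (i < j)%N; case: (j < k)%N; case: (k < l)%N.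
Qed.

(** Reversal lists a quadruplet in the opposite order, so the parity read on the
   third element is afterwards read on the second one. *)
Lemma count_quadruplets_rev (P Q : 'I_N -> 'I_N -> 'I_N -> 'I_N -> bool) :
  (forall i j k l, P i j k l = Q (rev_ord l) (rev_ord k) (rev_ord j) (rev_ord i)) ->
  count_quadruplets P = count_quadruplets Q.
Proof.
move=> PQ; pose f (q : 'I_N * 'I_N * 'I_N * 'I_N) :=
  (rev_ord q.2, rev_ord q.1.2, rev_ord q.1.1.2, rev_ord q.1.1.1).
apply: (@card_set_inj _ f) => [|q]; last exact: PQ.
by apply: can_inj (f) _ => -[[[i j] k] l]; rewrite /f /= !rev_ordK.
Qed.

(** On {1, ..., N} reversal is i |-> N + 1 - i, which changes parity for N even. *)
Hypothesis N_even : ~~ odd N.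

Lemma elt_odd_rev (i : 'I_N) : elt_odd (rev_ord i) = elt_even i.
Proof. by rewrite /elt_odd /elt_even /=; have := ltn_ord i; lia. Qed.

Lemma elt_even_rev (i : 'I_N) : elt_even (rev_ord i) = elt_odd i.
Proof. by rewrite -elt_odd_rev rev_ordK. Qed.

Lemma weight_rev s : is_fpf_involution s ->
  weight_peak s = weight_valley (rev_conj s).
Proof.
case/fpf_involutionP=> sK _.
(* All the exchanges that concern a single position. *)
have pos_rev := (is_cvalley_rev, is_record_rev, elt_odd_rev, elt_even_rev).
rewrite /weight_peak /weight_valley.
have -> : ecpar s = ocvr (rev_conj s).
  by apply: (card_set_inj rev_ord_inj) => i; rewrite !pos_rev.
have -> : ocpar s = ecvr (rev_conj s).
  by apply: (card_set_inj rev_ord_inj) => i; rewrite !pos_rev.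
have -> : ecpnar s = ocvnr (rev_conj s).
  by apply: (card_set_inj rev_ord_inj) => i; rewrite !pos_rev.
have -> : ocpnar s = ecvnr (rev_conj s).
  by apply: (card_set_inj rev_ord_inj) => i; rewrite !pos_rev.
have -> : ecr3 s = ocr (rev_conj s).
  by apply: count_quadruplets_rev => i j k l; rewrite is_crossing_rev ?elt_odd_rev.
have -> : ocr3 s = ecr (rev_conj s).
  by apply: count_quadruplets_rev => i j k l; rewrite is_crossing_rev ?elt_even_rev.
have -> : ene3 s = Defs.one (rev_conj s).
  by apply: count_quadruplets_rev => i j k l; rewrite is_nesting_rev ?elt_odd_rev.
have -> : one3 s = ene (rev_conj s).
  by apply: count_quadruplets_rev => i j k l; rewrite is_nesting_rev ?elt_even_rev.
by [].
Qed.

End Reversal.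

(** * Reading an involution from right to left *)

(** An element of a finite set of positions is determined by the number of
   elements on its right, which can be any k < #|A|; the remaining #|A| - k - 1
   elements are on its left. *)
Lemma sum_ranks (R : nmodType) N (F : nat -> nat -> R) (A : {set 'I_N}) :
  \sum_(c in A) F #|[set d in A | (c < d)%N]| #|[set d in A | (d < c)%N]|
  = \sum_(k < #|A|) F k (#|A| - k.+1)%N.
Proof.
move: {2}#|A| (erefl #|A|) F => n; elim: n A => [|n IHn] A card_A F.
  by move/cards0_eq: card_A => ->; rewrite !big_set0 cards0 big_ord0.
have [a0 a0A] : exists a, a \in A by apply/card_gt0P; rewrite card_A.
(* The maximum has k = 0; for every other element it adds one to k. *)
pose a := [arg max_(i > a0 in A) nat_of_ord i].
have [aA a_max] : a \in A /\ forall d, d \in A -> (d <= a)%N.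
  by rewrite /a; case: arg_maxnP.
have card_Aa : #|A :\ a| = n by move: card_A; rewrite (cardsD1 a) aA => -[].
rewrite card_A big_ord_recl subSS subn0 (bigD1 a) //=; congr (_ + _).
  congr F; last first.
    rewrite -card_Aa; apply: eq_card => d; rewrite !inE.
    by have := a_max d; rewrite ltn_neqAle; case: (d \in A) => [->|]; rewrite ?andbF ?andbT.
  apply: eq_card0 => d; rewrite !inE; apply/andP=> -[/a_max le_da].
  by rewrite ltnNge le_da.
transitivity (\sum_(c in A :\ a) F #|[set d in A :\ a | (c < d)%N]|.+1
                                   #|[set d in A :\ a | (d < c)%N]|).
  apply: eq_big => c; first by rewrite !inE andbC.
  case/andP=> cA ne_ca; have lt_ca : (c < a)%N by rewrite ltn_neqAle ne_ca a_max.
  congr F; last first.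
    apply: eq_card => d; rewrite !inE; case: eqP => // ->.
    by rewrite ltnNge ltnW // andbF.
  rewrite [LHS](cardsD1 a) inE aA lt_ca; congr _.+1.
  by apply: eq_card => d; rewrite !inE andbA.
rewrite (IHn (A :\ a) card_Aa (fun k => F k.+1)) card_Aa.
by apply: eq_bigr => k _; rewrite /= /bump add1n subSS.
Qed.

Section Scan.
Variable N : nat.
Implicit Types (s t : {perm 'I_N}) (i c : 'I_N).

Definition nests s i := #|[set j : 'I_N | (j < i)%N && (s i < s j)%N]|.
Definition crosses s i := #|[set j : 'I_N | [&& j < i, i < s j & s j < s i]%N]|.

(** An involution [t] that records the arcs whose two ends are among the
   positions from [m] on, already read, and fixes every other position. *)
Definition partial_matching t m : Prop :=
  involutive t /\ forall i : 'I_N, (i < m)%N -> t i = i.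

(** The fixed points that are at least [m] are the elements read so far and
   still unmatched. *)
Definition open_from t m : {set 'I_N} := [set i : 'I_N | (m <= i)%N && (t i == i)].

(** The involutions that remain possible after the positions from [m] on have
   been read: an unmatched element has its partner further left. *)
Definition extends_from t m s : bool :=
  [forall i : 'I_N, (m <= i)%N ==> if t i == i then (s i < m)%N else s i == t i].

(** Reading a peak at [m] leaves it unmatched. *)
Lemma extends_openP t (m : 'I_N) s : partial_matching t m.+1 ->
  is_fpf_involution s ->
  extends_from t m.+1 s && (s m < m)%N = extends_from t m s.
Proof.
move=> [tK t_fix] /fpf_involutionP[sK s_fpf].
apply/andP/forallP => [[/forallP ext_s lt_sm] i | ext_s].
  apply/implyP; rewrite leq_eqVlt => /orP[/eqP/val_inj <-|lt_mi].
    by rewrite t_fix // eqxx.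
  have := ext_s i; rewrite lt_mi /=; case: eqP => // _.
  rewrite ltnS leq_eqVlt => /orP[/eqP/val_inj def_m|//].
  by move: lt_sm; rewrite -def_m sK def_m ltnNge ltnW.
split; last by have := ext_s m; rewrite leqnn t_fix // eqxx.
apply/forallP=> i; apply/implyP => lt_mi; have := ext_s i.
by rewrite ltnW //=; case: eqP => // _ /leqW.
Qed.

(** Reading a valley at [m] with partner [c] adds the arc (m, c). *)
Lemma extends_closeP t (m c : 'I_N) s : partial_matching t m.+1 ->
  c \in open_from t m.+1 -> is_fpf_involution s ->
  extends_from t m.+1 s && (s m == c) = extends_from (t * tperm m c) m s.
Proof.
move=> [tK t_fix]; rewrite inE => /andP[lt_mc /eqP tc].
move=> /fpf_involutionP[sK s_fpf].
have tm : t m = m by exact: t_fix.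
have ne_mc : m != c by rewrite neq_ltn lt_mc.
have t'm : (t * tperm m c)%g m = c by rewrite permM tm tpermL.
have t'c : (t * tperm m c)%g c = m by rewrite permM tc tpermR.
have t'E i : i != m -> i != c -> (t * tperm m c)%g i = t i.
  move=> ne_im ne_ic; rewrite permM tpermD // eq_sym.
    by rewrite -[X in _ != X]tm (inj_eq perm_inj).
  by rewrite -[X in _ != X]tc (inj_eq perm_inj).
apply/andP/forallP => [[/forallP ext_s /eqP sm] i | ext_s].
  apply/implyP; rewrite leq_eqVlt => /orP[/eqP/val_inj <-|lt_mi].
    by rewrite t'm eq_sym (negPf ne_mc) sm.
  have [->|ne_ic] := eqVneq i c; first by rewrite t'c (negPf ne_mc) -sm sK.
  have ne_im : i != m by rewrite neq_ltn lt_mi orbT.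
  rewrite t'E //; have := ext_s i; rewrite lt_mi /=; case: eqP => // _.
  rewrite ltnS leq_eqVlt => /orP[/eqP/val_inj def_m|//].
  by move: ne_ic; rewrite -sm -def_m sK eqxx.
have sm : s m = c.
  by have := ext_s m; rewrite leqnn t'm eq_sym (negPf ne_mc) => /eqP.
split; last by rewrite sm.
apply/forallP=> i; apply/implyP => lt_mi.
have [->|ne_ic] := eqVneq i c; first by rewrite tc eqxx -sm sK.
have ne_im : i != m by rewrite neq_ltn lt_mi orbT.
have := ext_s i; rewrite (ltnW lt_mi) /= t'E //.
by case: eqP => // _ /leqW.
Qed.

Lemma partial_matching_close t (m c : 'I_N) : partial_matching t m.+1 ->
  c \in open_from t m.+1 -> partial_matching (t * tperm m c) m.
Proof.
move=> [tK t_fix]; rewrite inE => /andP[lt_mc /eqP tc].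
have tm : t m = m by exact: t_fix.
split=> [i|i lt_im]; last first.
  rewrite permM t_fix; last exact: leqW.
  by rewrite tpermD // neq_ltn ?lt_im ?orbT // (ltn_trans lt_im lt_mc) orbT.
have [->|ne_im] := eqVneq i m; first by rewrite !permM tm tpermL tc tpermR.
have [->|ne_ic] := eqVneq i c; first by rewrite !permM tc tpermR tm tpermL.
have ne_tm : t i != m by rewrite -tm (inj_eq perm_inj).
have ne_tc : t i != c by rewrite -tc (inj_eq perm_inj).
by rewrite !permM [tperm m c (t i)]tpermD ?[_ == t i]eq_sym // tK tpermD // eq_sym.
Qed.

Lemma open_from_close t (m c : 'I_N) : partial_matching t m.+1 ->
  c \in open_from t m.+1 ->
  open_from (t * tperm m c) m = open_from t m.+1 :\ c.
Proof.
move=> [tK t_fix]; rewrite inE => /andP[lt_mc /eqP tc].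
have tm : t m = m by exact: t_fix.
have ne_mc : m != c by rewrite neq_ltn lt_mc.
apply/setP=> i; rewrite !inE permM.
have [->|ne_ic] := eqVneq i c; first by rewrite tc tpermR (negPf ne_mc) andbF.
have [->|ne_im] := eqVneq i m.
  by rewrite tm tpermL leqnn ltnn eq_sym (negPf ne_mc).
have ne_tm : t i != m by rewrite -tm (inj_eq perm_inj).
have ne_tc : t i != c by rewrite -tc (inj_eq perm_inj).
rewrite tpermD ?[_ == t i]eq_sym // [(m < i)%N]ltn_neqAle.
by rewrite (inj_eq val_inj m i) [m == i]eq_sym ne_im.
Qed.

Lemma open_from_open t (m : 'I_N) : partial_matching t m.+1 ->
  open_from t m = m |: open_from t m.+1.
Proof.
move=> [tK t_fix]; apply/setP=> i; rewrite !inE.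
have [->|ne_im] := eqVneq i m; first by rewrite leqnn t_fix ?eqxx.
by rewrite [(m < i)%N]ltn_neqAle (inj_eq val_inj m i) [m == i]eq_sym ne_im.
Qed.

(** Apart from the partner of [m], the elements still unmatched are the right
   ends of the arcs passing over [m]. *)
Lemma open_partner t (m c : 'I_N) s : partial_matching t m.+1 ->
  is_fpf_involution s -> extends_from t m.+1 s -> s m = c ->
  forall d, (d \in open_from t m.+1) && (d != c) = (m < d)%N && (s d < m)%N.
Proof.
move=> [tK t_fix] /fpf_involutionP[sK s_fpf] /forallP ext_s sm d; rewrite inE.
case: (ltnP m d) => //= lt_md; have := ext_s d; rewrite lt_md /=.
case: eqP => [_|/eqP ne_td /eqP sd] /=.
  rewrite ltnS [in RHS]ltn_neqAle => ->; rewrite andbT.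
  by rewrite (inj_eq val_inj (s d) m) invol_eq // sm eq_sym.
symmetry; apply/negbTE; rewrite sd; apply/negP=> lt_tm.
by move: ne_td; rewrite -[X in _ == X]tK (t_fix (t d)) ?eqxx // ltnW.
Qed.

Lemma valley_partner_open t (m : 'I_N) s : partial_matching t m.+1 ->
  is_fpf_involution s -> extends_from t m.+1 s -> ~~ (s m < m)%N ->
  s m \in open_from t m.+1.
Proof.
move=> [tK t_fix] /fpf_involutionP[sK s_fpf] /forallP ext_s.
rewrite -leqNgt leq_eqVlt (inj_eq val_inj) eq_sym (negPf (s_fpf m)) /= => lt_ms.
rewrite inE lt_ms; have := ext_s (s m); rewrite lt_ms /= sK.
case: eqP => // ne_t /eqP tm; case: ne_t.
by rewrite -[X in _ = X]tK -tm (t_fix m).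
Qed.

Lemma nestsE t (m c : 'I_N) s : partial_matching t m.+1 ->
  is_fpf_involution s -> extends_from t m.+1 s -> s m = c ->
  c \in open_from t m.+1 ->
  nests s m = #|[set d in open_from t m.+1 | (c < d)%N]|.
Proof.
move=> pt fpf_s ext_s sm c_open; have [sK _] := fpf_involutionP _ fpf_s.
have := open_partner pt fpf_s ext_s sm.
move: c_open; rewrite inE => /andP[lt_mc _] partner.
apply: (card_set_inj (@perm_inj _ s)) => i.
rewrite sm andbC; case: (ltnP c (s i)) => [lt_cs|]; rewrite ?andbF //= andbT.
have := partner (s i); rewrite sK (ltn_trans lt_mc lt_cs) /= => <-.
by rewrite (neq_ltn (s i)) lt_cs orbT andbT.
Qed.

Lemma crossesE t (m c : 'I_N) s : partial_matching t m.+1 ->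
  is_fpf_involution s -> extends_from t m.+1 s -> s m = c ->
  c \in open_from t m.+1 ->
  crosses s m = #|[set d in open_from t m.+1 | (d < c)%N]|.
Proof.
move=> pt fpf_s ext_s sm c_open; have [sK _] := fpf_involutionP _ fpf_s.
have partner := open_partner pt fpf_s ext_s sm.
apply: (card_set_inj (@perm_inj _ s)) => i.
rewrite sm andbA; case: (ltnP (s i) c) => [lt_sc|]; rewrite ?andbF //= !andbT.
by have := partner (s i); rewrite sK (neq_ltn (s i)) lt_sc /= andbT andbC => <-.
Qed.

Section Sum.
Variable R : comNzRingType.
Variable w : bool -> nat -> nat -> R.
Variable alpha : nat -> R.
Hypothesis alphaE : forall h, alpha h.+1 = \sum_(k < h.+1) w (odd h) k (h - k).

(** The positions below [m], which remain to be read, form a path of [m] steps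
   from height 0 to the number of unmatched elements: a valley is a rise and a
   peak is a fall. Since each step changes the height by one, the hypothesis on
   parities holds at every stage; it expresses the parity of a valley by its
   height, as [alphaE] requires. *)
Lemma sum_extensions m t : (m <= N)%N -> partial_matching t m ->
  odd m = odd #|open_from t m| ->
  \sum_(s | is_fpf_involution s && extends_from t m s)
     \prod_(i : 'I_N | (i < m)%N && (i < s i)%N) w (odd i) (nests s i) (crosses s i)
  = path_sum alpha m #|open_from t m|.
Proof.
elim: m t => [|m IHm] t le_mN pt odd_open.
  (* Nothing is left to read: only [t] itself extends [t], and it does so when
     no element is left unmatched. *)
  under eq_bigr do rewrite big_pred0_eq.
  have [h0|h_gt0] := posnP #|open_from t 0|.
    have t_fpf : is_fpf_involution t.
      apply/fpf_involutionP; split=> [|i]; first by case: pt.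
      by apply/eqP=> ti; have := in_set0 i; rewrite -(cards0_eq h0) inE ti eqxx.
    rewrite h0 (big_pred1 t) // => s; apply/andP/eqP => [[_ /forallP ext_s]|->].
      apply/permP=> i; have := ext_s i; case/fpf_involutionP: t_fpf => _ /(_ i).
      by move/negPf=> -> /eqP.
    split=> //; apply/forallP=> i; case/fpf_involutionP: t_fpf => _ /(_ i).
    by move/negPf=> ->; rewrite eqxx.
  rewrite /= -(negbK (_ == _)) -lt0n h_gt0 big_pred0 // => s.
  apply/andP=> -[_ /forallP ext_s].
  have [i] := card_gt0P h_gt0; rewrite inE => /andP[_ ti].
  by have := ext_s i; rewrite ti.
pose i0 := Ordinal le_mN; set O := open_from t m.+1.
have pt' : partial_matching t i0 by case: pt => tK t_fix; split=> // i /leqW/t_fix.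
have i0_open : i0 \notin O by rewrite inE ltnn.
have ltS i : i != i0 -> (i < m.+1)%N = (i < i0)%N.
  by move=> ne_i; rewrite ltnS leq_eqVlt (inj_eq val_inj i i0) (negPf ne_i).
(* Either [m] is a peak, or it is a valley and is matched to some [c] in [O]. *)
rewrite (bigID (fun s => (s i0 < i0)%N)) /=; congr (_ + _).
  have openS : open_from t i0 = i0 |: O by exact: open_from_open.
  have card_open : #|open_from t m| = #|O|.+1 by rewrite openS cardsU1 i0_open.
  rewrite -card_open -(IHm t) ?(ltnW le_mN) //; last first.
    by rewrite card_open /= -odd_open /= negbK.
  apply: eq_big => [s|s /andP[_ lt_s0]].
    by case fpf_s: (is_fpf_involution s) => //=; exact: (@extends_openP t i0).
  apply: eq_bigl => i; have [->|/ltS -> //] := eqVneq i i0.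
  by rewrite [(i0 < s i0)%N]ltnNge (ltnW lt_s0) !andbF.
rewrite (partition_big (fun s => s i0) (mem O)) /=; last first.
  by move=> s /andP[/andP[fpf_s ext_s]]; apply: valley_partner_open.
transitivity (\sum_(c in O) w (odd m) #|[set d in O | (c < d)%N]|
                                     #|[set d in O | (d < c)%N]|
                * path_sum alpha m #|O|.-1).
  apply: eq_bigr => c cO.
  have card_c : #|open_from (t * tperm i0 c) m| = #|O|.-1.
    by rewrite (@open_from_close t i0) // (cardsD1 c O) cO.
  have card_O : #|O| = #|O|.-1.+1 by rewrite prednK //; apply/card_gt0P; exists c.
  rewrite -card_c -(IHm (t * tperm i0 c)%g) ?(ltnW le_mN) //; first last.
  - by rewrite card_c; move: odd_open; rewrite -/O card_O /= => /negb_inj.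
  - exact: (@partial_matching_close t i0).
  rewrite mulr_sumr; apply: eq_big => [s|s].
    case fpf_s: (is_fpf_involution s) => //=.
    rewrite -(@extends_closeP t i0) // -andbA; congr (_ && _).
    case: eqP => [->|]; rewrite ?andbF // andbT -leqNgt.
    by move: cO; rewrite inE => /andP[/ltnW].
  case/andP=> /andP[/andP[fpf_s ext_s] lt_s0] /eqP s0.
  rewrite (bigD1 i0) /=; last by rewrite ltnSn s0; move: cO; rewrite inE => /andP[].
  rewrite (@nestsE t i0 c) // (@crossesE t i0 c) //; congr (_ * _).
  apply: eq_bigl => i; have [->|ne_i] := eqVneq i i0; first by rewrite !ltnn andbF.
  by rewrite andbT ltS.
rewrite -mulr_suml sum_ranks; move: odd_open; rewrite -/O.
case: #|O| => [|h] /=; first by rewrite big_ord0 mul0r.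
by move/negb_inj=> ->; rewrite alphaE.
Qed.

End Sum.
End Scan.

(** * The weight as a product over valleys *)

Lemma exp_card (R : comNzRingType) (T : finType) (a : R) (P Q : pred T) :
  a ^+ #|[set i | P i && Q i]| = \prod_(i | P i) (if Q i then a else 1).
Proof.
by rewrite -big_mkcondr -prodr_const; apply: eq_bigl => i; rewrite inE.
Qed.

Section Weights.
Variable N : nat.
Implicit Types (s t : {perm 'I_N}) (i j k l : 'I_N).

(** In a crossing or a nesting of a given permutation, the first two elements
   determine the other two. *)
Lemma count_by_second (P : 'I_N -> 'I_N -> 'I_N -> 'I_N -> bool)
    (V : pred 'I_N) (A : 'I_N -> {set 'I_N}) (f g : 'I_N -> 'I_N -> 'I_N) :
  (forall i j k l, P i j k l = [&& V j, i \in A j, k == f i j & l == g i j]) ->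
  count_quadruplets P = (\sum_(j | V j) #|A j|)%N.
Proof.
move=> PE; under [RHS]eq_bigr do rewrite -sum1_card.
rewrite pair_big_dep /= /count_quadruplets -sum1dep_card.
rewrite (reindex_onto (fun p : 'I_N * 'I_N => (p.2, p.1, f p.2 p.1, g p.2 p.1))
                      (fun q => (q.1.1.2, q.1.1.1))) /=.
  by apply: eq_bigl => -[j i]; rewrite PE /= !eqxx !andbT.
by move=> [[[i j] k] l]; rewrite PE /= => /and4P[_ _ /eqP<- /eqP<-].
Qed.

Lemma count_crossings s (E : pred 'I_N) :
  count_quadruplets (fun i j k l => is_crossing s i j k l && E j)
  = (\sum_(j : 'I_N | (j < s j)%N) if E j then crosses s j else 0)%N.
Proof.
rewrite -big_mkcondr; apply: (count_by_second (f := fun i _ => s i) (g := fun _ => s)).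
move=> i j k l; rewrite /is_crossing inE ![_ == s _]eq_sym.
case: eqP => [->|]; case: eqP => [->|]; rewrite ?andbF //= !andbT.
case: (E j); rewrite ?andbF ?andbT //; case: (ltnP i j); rewrite ?andbF //= => _.
apply/andP/and3P => [[lt_ji lt_ij]|[]] //.
by split=> //; apply: ltn_trans lt_ij.
Qed.

Lemma count_nestings s (E : pred 'I_N) :
  count_quadruplets (fun i j k l => is_nesting s i j k l && E j)
  = (\sum_(j : 'I_N | (j < s j)%N) if E j then nests s j else 0)%N.
Proof.
rewrite -big_mkcondr; apply: (count_by_second (f := fun _ => s) (g := fun i _ => s i)).
move=> i j k l; rewrite /is_nesting inE ![_ == s _]eq_sym.
case: (s j =P k) => [->|]; case: (s i =P l) => [->|]; rewrite ?andbF //= !andbT.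
by case: (E j); rewrite ?andbF ?andbT // andbCA.
Qed.

Lemma is_record_nests s i : is_record s i = (nests s i == 0%N).
Proof.
rewrite cards_eq0; apply/forallP/eqP => [rec_i|nests0 j].
  apply/setP=> j; rewrite !inE; apply/andP=> -[lt_ji].
  by have := rec_i j; rewrite lt_ji ltnNge /= => /negP le_ij /ltnW.
apply/implyP=> lt_ji; have := in_set0 j; rewrite -nests0 inE lt_ji /=.
rewrite ltnNge => /negbFE; rewrite leq_eqVlt (inj_eq val_inj) (inj_eq perm_inj).
by case/orP=> // /eqP def_j; rewrite def_j ltnn in lt_ji.
Qed.

(** The positions start at 0 here, so an odd [b] stands for an even element. *)
Definition valley_factor (b : bool) (k c : nat) : pol :=
  if b then (if k == 0%N then y_ else v_) * p_plus ^+ c * q_plus ^+ k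
  else (if k == 0%N then x_ else u_) * p_minus ^+ c * q_minus ^+ k.

Lemma weight_valleyE s : is_fpf_involution s ->
  weight_valley s
  = \prod_(i : 'I_N | (i < s i)%N) valley_factor (odd i) (nests s i) (crosses s i).
Proof.
move=> /fpf_involutionP[sK _].
have sV : s^-1%g = s by apply/permP=> i; apply: (@perm_inj _ s); rewrite permKV sK.
have valleyE i : is_cvalley s i = (i < s i)%N by rewrite /is_cvalley sV andbb.
have cardE (a : pol) (Q : pred 'I_N) :
  a ^+ #|[set i | is_cvalley s i && Q i]|
  = \prod_(i : 'I_N | (i < s i)%N) (if Q i then a else 1).
  by rewrite exp_card; apply: eq_bigl.
have expE (a : pol) (E : pred 'I_N) (F : 'I_N -> nat) :
  a ^+ (\sum_(i : 'I_N | (i < s i)%N) if E i then F i else 0)%N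
  = \prod_(i : 'I_N | (i < s i)%N) (if E i then a ^+ F i else 1).
  by rewrite -prodrXr; apply: eq_bigr => i _; case: (E i).
rewrite /weight_valley /ocvr /ecvr /ocvnr /ecvnr /ecr /ocr /ene /Defs.one.
rewrite !count_crossings !count_nestings !cardE !expE -!big_split /=.
apply: eq_bigr => i _; rewrite is_record_nests /elt_odd /elt_even /= negbK.
by rewrite /valley_factor; case: (odd i); case: eqP; rewrite ?(mul1r, mulr1).
Qed.

End Weights.

(** The coefficient of the continued fraction, as the sum over the number [k] of
   nestings out of [h] arcs; the term k = 0 is the case of a record. *)
Lemma sum_factors (R : comNzRingType) (p q a b : R) h :
  \sum_(k < h.+1) (if k == 0 :> nat then a else b) * p ^+ (h - k) * q ^+ k
  = p ^+ h * a + q * pq_int p q h * b.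
Proof.
rewrite big_ord_recl /= subn0 mulr1 mulrC; congr (_ + _).
rewrite /pq_int (reindex_inj rev_ord_inj) /= mulr_sumr mulr_suml.
apply: eq_bigr => i _; rewrite /bump add1n.
have [-> ->] : (h - (h - i.+1).+1 = i /\ h - 1 - i = h - i.+1)%N.
  by have := ltn_ord i; lia.
by rewrite exprS -mulrA mulrC mulrCA.
Qed.

(** The reading starts at the right end with no arc known, i.e. with the identity. *)
Lemma path_sum_valley (alpha : nat -> pol) :
  (forall h, alpha h.+1 = \sum_(k < h.+1) valley_factor (odd h) k (h - k)) ->
  forall n, M_valley n = path_sum alpha n.*2 0.
Proof.
move=> alphaE n; rewrite -mul2n.
have pt : partial_matching (1 : {perm 'I_(2 * n)})%g (2 * n).
  by split=> i; rewrite ?perm1.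
have open0 : open_from (1 : {perm 'I_(2 * n)})%g (2 * n) = set0.
  by apply/setP=> i; rewrite !inE leqNgt ltn_ord.
have := sum_extensions alphaE (leqnn _) pt.
rewrite open0 cards0 mul2n odd_double -mul2n => <- //.
apply: eq_big => [s|s].
  rewrite inE; case: is_fpf_involution => //=; symmetry.
  by apply/forallP=> i; rewrite leqNgt ltn_ord.
rewrite inE => /weight_valleyE ->.
by apply: eq_bigl => i; rewrite ltn_ord.
Qed.

(** * The continued fraction *)

Theorem theorem4p4 :
  (forall n : nat,
     [/\ {in fpf_involutions n &, injective (@rev_conj (2 * n))},
         [set rev_conj s | s in fpf_involutions n] = fpf_involutions n,
         (forall s : {perm 'I_(2 * n)}, s \in fpf_involutions n ->
            weight_peak s = weight_valley (rev_conj s))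
       & M_peak n = M_valley n])
  /\
  (forall alpha : nat -> pol,
     (forall k : nat, (1 <= k)%N ->
        alpha (2 * k - 1)%N
          = p_minus ^+ (2 * k - 2) * x_
            + q_minus * pq_int p_minus q_minus (2 * k - 2) * u_
        /\
        alpha (2 * k)%N
          = p_plus ^+ (2 * k - 1) * y_
            + q_plus * pq_int p_plus q_plus (2 * k - 1) * v_) ->
     is_Sfrac alpha M_valley).
Proof.
split=> [n | alpha alphaP].
  have even_2n : ~~ odd (2 * n) by rewrite mul2n odd_double.
  have rev_in s : (rev_conj s \in fpf_involutions n) = (s \in fpf_involutions n).
    by rewrite !inE rev_conj_fpf.
  have weightE s : s \in fpf_involutions n ->
      weight_peak s = weight_valley (rev_conj s).
    by rewrite inE; apply: weight_rev.
  split=> //.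
  - by move=> s t _ _; apply: (can_inj (@rev_conjK _)).
  - apply/setP=> s; apply/imsetP/idP => [[t tP ->]|sP]; first by rewrite rev_in.
    by exists (rev_conj s); rewrite ?rev_conjK ?rev_in.
  rewrite /M_peak /M_valley [RHS](reindex_inj (can_inj (@rev_conjK _))) /=.
  by apply: eq_big => [s|s /weightE //]; rewrite rev_in.
apply: (@is_Sfrac_eq _ _ (fun n => path_sum alpha n.*2 0)); last first.
  exact: path_sum_is_Sfrac.
move=> n; rewrite (@path_sum_valley alpha) // => h.
have [odd_h|even_h] := boolP (odd h); rewrite /valley_factor sum_factors.
  have [_] := alphaP (h.+1)./2 ltac:(lia).
  by have [-> ->] : (2 * (h.+1)./2 - 1 = h /\ 2 * (h.+1)./2 = h.+1)%N by lia.
have [] := alphaP (h.+2)./2 ltac:(lia).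
by have [-> ->] : (2 * (h.+2)./2 - 1 = h.+1 /\ 2 * (h.+2)./2 - 2 = h)%N by lia.
Qed.
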